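(* Let $n$ be a positive integer. For an integer $m\ge 1$, let $\mathrm{H}_n$ be the $n\times n$ circulant matrix whose first row is $\left((-1)^{i-1}H_i(m,n)\right)_{i=1,\dots,n}$, and let $\mathrm{K}_n$ be the $n\times n$ circulant matrix whose first row is $\left((-1)^{i-1}K_i(m,n)\right)_{i=1,\dots,n}$, where $H_i(m,n)$ and $K_i(m,n)$ are the difference hyperbolic and difference trigonometric functions of order $n$. 1) If $n$ is even, then for every $m\ge 1$, $\det \mathrm{H}_n=0$. 2) If $n$ is odd, then for every $m\ge 1$, $\det \mathrm{K}_n=0$.
   Context: For a function $f$ of a nonnegative integer variable $m$, set $\Delta f(m)=f(m+1)-f(m)$. Fix a positive integer $n$. The difference hyperbolic functions of order $n$, $H_1(m,n),\dots,H_n(m,n)$ (with $m$ a nonnegative integer variable), are the functions $y_s(m)=H_s(m,n)$ forming the solution of the system of difference equations $$\Delta y_s(m)=y_{s-1}(m),\quad s=2,3,\dots,n,\qquad \Delta y_1(m)=y_n(m),$$ with initial values $y_1(0)=1$ and $y_s(0)=0$ for $s=2,\dots,n$. The difference trigonometric functions of order $n$, $K_1(m,n),\dots,K_n(m,n)$ (with $m$ a nonnegative integer variable), are the functions $y_s(m)=K_s(m,n)$ forming the solution of the system of difference equations $$\Delta y_s(m)=y_{s-1}(m),\quad s=2,3,\dots,n,\qquad \Delta y_1(m)=-y_n(m),$$ with initial values $y_1(0)=1$ and $y_s(0)=0$ for $s=2,\dots,n$. A circulant matrix with first row $(c_1,\dots,c_n)$ is the $n\times n$ matrix in which each row after the first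 is obtained from the previous row by a cyclic shift one position to the right. *)

(* Defs.v *)
From HB Require Import structures.
From mathcomp Require Import all_boot all_order all_algebra.

Set Implicit Arguments.
Unset Strict Implicit.
Unset Printing Implicit Defensive.

Import GRing.Theory.
Local Open Scope ring_scope.

Definition fdiff (R : zmodType) (f : nat -> R) (m : nat) : R := f m.+1 - f m.

(* A family is a function [y : nat -> nat -> R] with [y s m] standing for     *)
(* y_s(m); indices [s] are 1-based, and only 1 <= s <= n is constrained.      *)
Definition difference_hyperbolic (R : numDomainType) (n : nat)
    (y : nat -> nat -> R) : Prop :=
  [/\ forall s m : nat, (2 <= s <= n)%N -> fdiff (y s) m = y s.-1 m,
      forall m : nat, fdiff (y 1%N) m = y n m,
      y 1%N 0%N = 1 &
      forall s : nat, (2 <= s <= n)%N -> y s 0%N = 0].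

Definition difference_trigonometric (R : numDomainType) (n : nat)
    (y : nat -> nat -> R) : Prop :=
  [/\ forall s m : nat, (2 <= s <= n)%N -> fdiff (y s) m = y s.-1 m,
      forall m : nat, fdiff (y 1%N) m = - y n m,
      y 1%N 0%N = 1 &
      forall s : nat, (2 <= s <= n)%N -> y s 0%N = 0].

(* [ord_pred j] is j - 1 modulo n, so entry j - 1 moves to position j.        *)
Definition cshift_right (R : Type) (n : nat) (c : 'rV[R]_n) : 'rV[R]_n :=
  \row_j c 0 (ord_pred j).

Definition circulant (R : Type) (n : nat) (c : 'rV[R]_n) : 'M[R]_n :=
  \matrix_(i < n) iter i (@cshift_right R n) c.

(* [i : 'I_n] is 0-based: (-1)^(i-1) y_i for i = 1..n becomes (-1)^i y_(i+1). *)
Definition alternating_row (R : numDomainType) (n : nat)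
    (y : nat -> nat -> R) (m : nat) : 'rV[R]_n :=
  \row_(i < n) ((-1) ^+ i * y i.+1 m).

(* Both systems have exactly one solution, on the index range 1..n.           *)
Fixpoint solution (R : numDomainType) (eps : R) (n s m : nat) : R :=
  if m is m'.+1 then
    solution eps n s m' +
    (if s == 1%N then eps * solution eps n n m' else solution eps n s.-1 m')
  else (s == 1%N)%:R.

Lemma difference_hyperbolic_exists (R : numDomainType) (n : nat) :
  exists y : nat -> nat -> R, difference_hyperbolic n y.
Proof.
exists (solution 1 n); split=> //=.
- by case=> [|[|s]] m //= _; rewrite /fdiff /= addrC addKr.
- by move=> m; rewrite /fdiff /= addrC addKr mul1r.
- by case=> [|[|s]].
Qed.

Lemma difference_trigonometric_exists (R : numDomainType) (n : nat) :
  exists y : nat -> nat -> R, difference_trigonometric n y.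
Proof.
exists (solution (-1) n); split=> //=.
- by case=> [|[|s]] m //= _; rewrite /fdiff /= addrC addKr.
- by move=> m; rewrite /fdiff /= addrC addKr mulN1r.
- by case=> [|[|s]].
Qed.

Lemma difference_hyperbolic_unique (R : numDomainType) (n : nat)
    (y z : nat -> nat -> R) :
  difference_hyperbolic n y -> difference_hyperbolic n z ->
  forall s m : nat, (1 <= s <= n)%N -> y s m = z s m.
Proof.
move=> [y1 y2 y3 y4] [z1 z2 z3 z4] s m; elim: m s => [|m IH] [|[|s]] //= hs.
- by rewrite y3 z3.
- by rewrite y4 ?z4.
- rewrite -[y _ _](subrK (y 1%N m)) -[z _ _](subrK (z 1%N m)).
  rewrite -![_ - _]/(fdiff _ _) y2 z2 (IH 1%N) // (IH n) //.
  by rewrite leqnn andbT.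
- rewrite -[y _ _](subrK (y s.+2 m)) -[z _ _](subrK (z s.+2 m)).
  rewrite -![_ - _]/(fdiff _ _) y1 // z1 //= (IH s.+1) ?(IH s.+2) //=.
  exact: ltnW.
Qed.

Lemma difference_trigonometric_unique (R : numDomainType) (n : nat)
    (y z : nat -> nat -> R) :
  difference_trigonometric n y -> difference_trigonometric n z ->
  forall s m : nat, (1 <= s <= n)%N -> y s m = z s m.
Proof.
move=> [y1 y2 y3 y4] [z1 z2 z3 z4] s m; elim: m s => [|m IH] [|[|s]] //= hs.
- by rewrite y3 z3.
- by rewrite y4 ?z4.
- rewrite -[y _ _](subrK (y 1%N m)) -[z _ _](subrK (z 1%N m)).
  rewrite -![_ - _]/(fdiff _ _) y2 z2 (IH 1%N) // (IH n) //.
  by rewrite leqnn andbT.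
- rewrite -[y _ _](subrK (y s.+2 m)) -[z _ _](subrK (z s.+2 m)).
  rewrite -![_ - _]/(fdiff _ _) y1 // z1 //= (IH s.+1) ?(IH s.+2) //=.
  exact: ltnW.
Qed.

(* Main.v *)
Require Import Defs.
From HB Require Import structures.
From mathcomp Require Import all_boot all_order all_algebra.
Local Open Scope ring_scope.

(** Every row of a circulant matrix is a rearrangement of the first one, so the
    all-ones column is an eigenvector whose eigenvalue is the sum of the first
    row; if that sum is zero, the matrix is singular
    ([det_circulant_sum0]).

    Both parts therefore reduce to the vanishing of
    [\sum_(i < n) (-1) ^+ i * y i.+1 m] for [m >= 1].  The two parities play the
    same role: in either case the system closes up with
    [fdiff (y 1) m = (-1) ^+ n * y n m], and with this sign the sum at time
    [m + 1] telescopes cyclically in terms of the values at time [m]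
    ([alternating_sum_eq0]). *)

Import GRing.Theory.

Lemma sum_iter_cshift_right (R : nmodType) (n k : nat) (c : 'rV[R]_n) :
  \sum_j iter k (@cshift_right R n) c 0 j = \sum_j c 0 j.
Proof.
elim: k => // k <-; rewrite [RHS](reindex (@ord_pred n)) /=.
  by apply: eq_bigr => j _; rewrite mxE.
exact/onW_bij/ord_pred_bij.
Qed.

(** The adjugate turns a nonzero kernel vector into the vanishing of the
    determinant without any division: if [A] kills the all-ones column [u],
    then [\det A *: u = \adj A *m A *m u = 0]. *)
Lemma det_circulant_sum0 (R : comNzRingType) (n : nat) (c : 'rV[R]_n) :
  (0 < n)%N -> \sum_j c 0 j = 0 -> \det (circulant c) = 0.
Proof.
move=> n_gt0 c0; pose u : 'cV[R]_n := const_mx 1.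
have Au0 : circulant c *m u = 0.
  apply/matrixP => i j; rewrite !mxE -[RHS]c0 -(sum_iter_cshift_right _ _ i).
  by apply: eq_bigr => k _; rewrite !mxE mulr1.
have := congr1 (mulmx (\adj (circulant c))) Au0.
rewrite mulmxA mul_adj_mx mul_scalar_mx mulmx0.
by move/matrixP/(_ (Ordinal n_gt0) 0); rewrite !mxE mulr1.
Qed.

(** With [u i = - (-1) ^+ i * y i m], the term of index [i > 0] at time [m + 1]
    is [u i.+1 - u i], while the sign [(-1) ^+ n] in the closing equation is the
    one that makes the term of index [0] equal to [u 1 - u n]. *)
Lemma alternating_sum_eq0 (R : pzRingType) (n : nat) (y : nat -> nat -> R) :
    (0 < n)%N ->
    (forall s m, (2 <= s <= n)%N -> fdiff (y s) m = y s.-1 m) ->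
    (forall m, fdiff (y 1%N) m = (-1) ^+ n * y n m) ->
  forall m, \sum_(i < n) (-1) ^+ i * y i.+1 m.+1 = 0.
Proof.
case: n => // n _ yS y1 m; pose u i : R := - ((-1) ^+ i * y i m).
have y_step s : y s m.+1 = y s m + fdiff (y s) m by rewrite addrC subrK.
rewrite big_ord_recl /= (eq_bigr (fun i : 'I_n => u i.+2 - u i.+1)); last first.
  move=> i _; rewrite /bump /= add1n y_step yS /=; last by rewrite ltnS ltn_ord.
  by rewrite mulrDr /u opprK !exprS !mulN1r !mulNr !opprK.
rewrite -(big_mkord xpredT (fun i => u i.+2 - u i.+1)).
rewrite (telescope_sumr (fun i => u i.+1)) // y_step y1 mul1r /u.
by rewrite expr1 mulN1r opprK -opprD [X in _ - X]addrC subrr.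
Qed.

Theorem theorem3 (R : numDomainType) (n : nat) (n_gt0 : (0 < n)%N)
    (H K : nat -> nat -> R)
    (H_hyp : difference_hyperbolic n H)
    (K_trig : difference_trigonometric n K) :
  (~~ odd n ->
     forall m : nat, (1 <= m)%N -> \det (circulant (alternating_row n H m)) = 0)
  /\
  (odd n ->
     forall m : nat, (1 <= m)%N -> \det (circulant (alternating_row n K m)) = 0).
Proof.
have det0 (y : nat -> nat -> R) :
    (forall s m, (2 <= s <= n)%N -> fdiff (y s) m = y s.-1 m) ->
    (forall m, fdiff (y 1%N) m = (-1) ^+ n * y n m) ->
  forall m, (1 <= m)%N -> \det (circulant (alternating_row n y m)) = 0.
  move=> yS y1 [//|m] _; apply: det_circulant_sum0 => //.
  rewrite -[RHS](@alternating_sum_eq0 _ _ _ n_gt0 yS y1 m).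
  by apply: eq_bigr => i _; rewrite mxE.
case: H_hyp K_trig => HS H1 _ _ [KS K1 _ _].
split=> odd_n; apply: det0 => // m.
  by rewrite H1 -signr_odd (negbTE odd_n) mul1r.
by rewrite K1 -signr_odd odd_n mulN1r.
Qed.
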